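(* Let $G=(V,E)$ be a directed graph with $m=|E|$, let $H$ be a maximal eulerian subgraph of $G$, let $r:V\to\mathbb{Z}$ be a rank function conforming $H$, and let $(p,s)\in E(H)$ be an edge with $\mathrm{slack}((p,s),r)>0$. Then the running time of $\mathrm{Relief}(H,r,G,p,s)$ is $O(m+\mathrm{slack}((p,s),r))$.
   Context: Graphs are finite and directed, $G=(V,E)$, $n=|V|$, $m=|E|$; subgraphs of $G$ are taken on the same vertex set $V$, and $E(H)$ is the edge set of $H$. A rank function is a map $r:V\to\mathbb{Z}$. An edge $(u,v)$ is forward w.r.t. $r$ if $r(u)<r(v)$ and backward if $r(u)\ge r(v)$. Slack: $\mathrm{slack}((u,v),r)=\max(r(v)-r(u)-1,0)$. A graph is eulerian if every vertex has in-degree equal to out-degree (connectivity is not required). A subgraph $H$ of $G$ is a maximal eulerian subgraph if it is eulerian and no eulerian subgraph of $G$ has an edge set strictly containing $E(H)$. A rank function $r$ conforms $H$ if all edges of $G$ that are backward w.r.t. $r$ lie in $E(H)$. Algorithm Relief$(H,r,G,p,s)$. Input: a graph $G=(V,E)$, a maximal eulerian subgraph $H$, a rank function $r$ conforming $H$, and an edge $(p,s)\in E(H)$ with $\mathrm{slack}((p,s),r)>0$. (1) Set $F:=E(H)$, $r':=r$, $t(v):=0$ for all $v\in V$; then set $t(p):=r(s)-r(p)-1$ and let $S$ be a priority queue (largest priority first) containing only $p$, with priority $t(p)$. (2) While $S$ is not empty: pop a vertex $u$ of highest priority from $S$ and set $r'(u):=r'(u)+t(u)$. For each $(u,v)\in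 E\setminus F$ with $r'(v)\le r'(u)$: let $t:=r'(u)+1-r'(v)$; if $t>t(v)$, set $t(v):=t$, add $v$ to $S$ with priority $t$ (updating its priority if $v$ is already in $S$), and set $\mathrm{parent}(v):=u$. Then for each $e=(w,u)\in F$ with $\mathrm{slack}(e,r')>\mathrm{slack}(e,r)$: let $t:=\mathrm{slack}(e,r')-\mathrm{slack}(e,r)$; if $t>t(w)$, set $t(w):=t$, add $w$ to $S$ with priority $t$ (updating its priority if $w$ is already in $S$), and set $\mathrm{parent}(w):=u$. (3) After the loop, if $\mathrm{slack}((p,s),r')>0$: let $O$ be the set of edges of $E$ along the path from $s$ to $p$ obtained by following the parent links (for each vertex $x\ne p$ on this path, the edge joining $x$ and $\mathrm{parent}(x)$ is the one that was being processed when $\mathrm{parent}(x)$ was last set); replace $F$ by $(F\setminus O)\cup(O\setminus F)$ and then delete $(p,s)$ from $F$. (4) Return $H'=(V,F)$ and $r'$. Running time counts elementary operations (integer arithmetic and comparisons at unit cost), the priority queue being implemented by a suitable data structure. In running-time bounds, $n=O(m)$ is understood, so $O(n+m)$ is written $O(m)$. *)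

(* Defs.v *)
From Stdlib Require Import String.
From mathcomp Require Import all_boot all_order all_algebra.

Set Implicit Arguments.
Unset Strict Implicit.
Unset Printing Implicit Defensive.

Import Order.TTheory GRing.Theory Num.Theory.
Local Open Scope ring_scope.

(** * Graphs and rank functions *)

(* A directed graph on the vertex set [V] is given by its edge set; since
   subgraphs keep the vertex set, a subgraph is a subset of the edge set. *)

Section Graphs.
Variable V : finType.
Implicit Types (E H : {set V * V}) (r : V -> int) (e : V * V).

Definition backward r e : bool := r e.2 <= r e.1.

Definition slack r e : int := Num.max (r e.2 - r e.1 - 1) 0.

Definition eulerian H : Prop :=
  forall v : V, #|[set e in H | e.2 == v]| = #|[set e in H | e.1 == v]|.

Definition maximal_eulerian E H : Prop :=
  [/\ H \subset E, eulerian H &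
      forall H', H' \subset E -> eulerian H' -> ~~ (H \proper H')].

Definition conforms E H r : Prop :=
  forall e, e \in E -> backward r e -> e \in H.

End Graphs.

(** * A random access machine with unit-cost operations *)

(* A memory consists of named integer variables and named integer arrays.
   No memory cell is assumed to be initialised. *)
Record store := Store {
  var : string -> int;
  arr : string -> int -> int
}.

Definition set_var (st : store) (x : string) (z : int) : store :=
  Store (fun y => if String.eqb x y then z else var st y) (arr st).

Definition set_arr (st : store) (a : string) (i z : int) : store :=
  Store (var st)
    (fun b j => if String.eqb a b && (i == j) then z else arr st b j).

Inductive binop := OpAdd | OpSub | OpMax.

Inductive expr :=
| Const of int
| Var of string
| Read of string & expr
| Op of binop & expr & expr.

Inductive test :=
| TEq of expr & expr
| TLe of expr & expr
| TLt of expr & expr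
| TNot of test.

Definition eval_op (o : binop) : int -> int -> int :=
  match o with
  | OpAdd => fun x y => x + y
  | OpSub => fun x y => x - y
  | OpMax => fun x y => Num.max x y
  end.

Fixpoint eval (st : store) (e : expr) : int :=
  match e with
  | Const z => z
  | Var x => var st x
  | Read a e1 => arr st a (eval st e1)
  | Op o e1 e2 => eval_op o (eval st e1) (eval st e2)
  end.

Fixpoint holds (st : store) (b : test) : bool :=
  match b with
  | TEq e1 e2 => eval st e1 == eval st e2
  | TLe e1 e2 => eval st e1 <= eval st e2
  | TLt e1 e2 => eval st e1 < eval st e2
  | TNot b1 => ~~ holds st b1
  end.

Fixpoint ecost (e : expr) : nat :=
  match e with
  | Const _ | Var _ => 1
  | Read _ e1 => (ecost e1).+1
  | Op _ e1 e2 => (ecost e1 + ecost e2).+1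
  end.

Fixpoint tcost (b : test) : nat :=
  match b with
  | TEq e1 e2 | TLe e1 e2 | TLt e1 e2 => (ecost e1 + ecost e2).+1
  | TNot b1 => (tcost b1).+1
  end.

(* [P] is the type of names of external procedures, and [Call x f es] stores
   the value returned by [f] in the variable [x]. *)
Inductive cmd (P : Type) :=
| Skip
| Assign of string & expr
| Write of string & expr & expr
| Seq of cmd P & cmd P
| If of test & cmd P
| While of test & cmd P
| Call of string & P & seq expr.

Arguments Skip {P}.
Arguments Assign {P}.
Arguments Write {P}.
Arguments Call {P}.

(* The external procedures work on a state of type [Q] of their own;
   [ext f args q z q' k] says that [f], called with the values [args] in state
   [q], returns [z] in state [q'] after [k] operations. *)
Definition ext_sem (P Q : Type) := P -> seq int -> Q -> int -> Q -> nat -> Prop.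

(* [exec ext c st q st' q' k]: started in the memory [st] and the external
   state [q], the command [c] terminates in [st'] and [q'], and it performs [k]
   elementary operations. *)
Inductive exec (P Q : Type) (ext : ext_sem P Q) :
    cmd P -> store -> Q -> store -> Q -> nat -> Prop :=
| ExecSkip st q :
    exec ext Skip st q st q 0
| ExecAssign x e st q :
    exec ext (Assign x e) st q (set_var st x (eval st e)) q (ecost e).+1
| ExecWrite a i e st q :
    exec ext (Write a i e) st q (set_arr st a (eval st i) (eval st e)) q
      (ecost i + ecost e).+1
| ExecSeq c1 c2 st q st1 q1 st2 q2 k1 k2 :
    exec ext c1 st q st1 q1 k1 -> exec ext c2 st1 q1 st2 q2 k2 ->
    exec ext (Seq c1 c2) st q st2 q2 (k1 + k2)
| ExecIfTrue b c st q st1 q1 k :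
    holds st b -> exec ext c st q st1 q1 k ->
    exec ext (If b c) st q st1 q1 ((tcost b).+1 + k)
| ExecIfFalse b c st q :
    ~~ holds st b ->
    exec ext (If b c) st q st q (tcost b).+1
| ExecWhileTrue b c st q st1 q1 st2 q2 k1 k2 :
    holds st b -> exec ext c st q st1 q1 k1 ->
    exec ext (While b c) st1 q1 st2 q2 k2 ->
    exec ext (While b c) st q st2 q2 ((tcost b).+1 + k1 + k2)
| ExecWhileFalse b c st q :
    ~~ holds st b ->
    exec ext (While b c) st q st q (tcost b).+1
| ExecCall x f es st q z q' k :
    ext f (map (eval st) es) q z q' k ->
    exec ext (Call x f es) st q (set_var st x z) q'
      ((sumn [seq (ecost e).+1 | e <- es]).+1 + k).

Declare Scope prog_scope.
Delimit Scope prog_scope with prog.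
Bind Scope prog_scope with expr test cmd.
Coercion Var : string >-> expr.

Notation "e1 + e2" := (Op OpAdd e1 e2) : prog_scope.
Notation "e1 - e2" := (Op OpSub e1 e2) : prog_scope.
Notation "a .[ i ]" := (Read a i) : prog_scope.
Notation "e1 =? e2" := (TEq e1 e2) (at level 70) : prog_scope.
Notation "e1 <=? e2" := (TLe e1 e2) (at level 70) : prog_scope.
Notation "e1 <? e2" := (TLt e1 e2) (at level 70) : prog_scope.
Notation "x ::= e" := (Assign x e) (at level 80) : prog_scope.
Notation "c1 ;; c2" := (Seq c1 c2) (at level 90, right associativity)
  : prog_scope.

Section Control.
Local Open Scope string_scope.
Local Open Scope prog_scope.
Variable P : Type.

Definition For (x : string) (lo hi : expr) (c : cmd P) : cmd P :=
  x ::= lo ;;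
  While (x <? hi) (c ;; x ::= x + Const 1).

End Control.

(** * Priority queues *)

Inductive pq_op := Init | Insert | IsEmpty | PopMax.

Record proc := Proc {
  params : seq string;
  body : cmd void;
  result : string
}.

(* An implementation of a priority queue has its own memory, which it can
   access only through the instructions of the machine. *)
Definition pq_impl := pq_op -> proc.

Definition bind_params (xs : seq string) (zs : seq int) (st : store) : store :=
  foldl (fun st1 xz => set_var st1 xz.1 xz.2) st (zip xs zs).

Definition no_ext : ext_sem void unit := fun _ _ _ _ _ _ => False.

Definition pq_call (Q : pq_impl) : ext_sem pq_op store :=
  fun f args st z st' k =>
    exec no_ext (body (Q f)) (bind_params (params (Q f)) args st) tt st' tt k
    /\ z = var st' (result (Q f)).

(* The abstract contents of a priority queue: the priority of each key that is
   in the queue. *)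
Definition contents := int -> option int.

Definition update (c : contents) (x : int) (o : option int) : contents :=
  fun y => if y == x then o else c y.

Definition inhabited_pq (c : contents) : Prop := exists x, c x <> None.

Definition is_max_key (c : contents) (x : int) : Prop :=
  exists2 t, c x = Some t & forall y t', c y = Some t' -> t' <= t.

(* [Q] implements priority queues whose keys are the integers [0, ..., n-1],
   where [n] is the argument of [Init], and whose priorities are positive
   integers.  [Insert x t] adds [x] with priority [t], or changes the priority
   of [x] to [t] if [x] is already present; [IsEmpty] returns a nonzero integer
   exactly if the queue is empty. *)
Definition pq_correct (Q : pq_impl) : Prop :=
  exists repr : nat -> contents -> store -> Prop,
  [/\ forall n st, exists z st' k,
        pq_call Q Init [:: n%:Z] st z st' k /\ repr n (fun=> None) st',
      forall n c st x t, repr n c st -> 0 <= x < n%:Z -> 0 < t ->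
        exists z st' k,
        pq_call Q Insert [:: x; t] st z st' k /\
        repr n (update c x (Some t)) st',
      forall n c st, repr n c st ->
        exists z st' k,
        [/\ pq_call Q IsEmpty [::] st z st' k, repr n c st' &
            (z != 0 <-> ~ inhabited_pq c)] &
      forall n c st, repr n c st -> inhabited_pq c ->
        exists x st' k,
        [/\ pq_call Q PopMax [::] st x st' k, is_max_key c x &
            repr n (update c x None) st']].

(** * The algorithm *)

(* The input graph is stored with its vertices numbered [0, ..., n-1] and its
   edges numbered [0, ..., m-1].  Edge [e] goes from [src.[e]] to [tgt.[e]], and
   [H.[e]] is its membership bit for [H].  The edges leaving vertex [u] are
   listed in [out] at the positions [outstart.[u], ..., outstart.[u+1] - 1], and
   those entering it in [in] at [instart.[u], ..., instart.[u+1] - 1].  The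
   variable [ps] holds the number of the edge [(p,s)].
   The output is left in the arrays [F] and [r'].  The edge joining [x] and
   [parent.[x]] along which [parent.[x]] was last set is [pedge.[x]], and the
   set [O] is represented by its membership bits. *)
Section Relief.
Local Open Scope string_scope.
Local Open Scope prog_scope.

Definition slack_expr (rk : string) (u v : expr) : expr :=
  Op OpMax (rk.[v] - rk.[u] - Const 1) (Const 0).

(* Offers [x] the priority [tnew], on behalf of the edge [e] from or to [u]. *)
Definition relax (x : string) : cmd pq_op :=
  If ("t".[x] <? "tnew")
    (Write "t" x "tnew" ;;
     Call "_" Insert [:: Var x; Var "tnew"] ;;
     Write "parent" x "u" ;;
     Write "pedge" x "e").

Definition relief_init : cmd pq_op :=
  For "e" (Const 0) "m" (Write "F" "e" ("H".["e"])) ;;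
  For "v" (Const 0) "n"
    (Write "r'" "v" ("r".["v"]) ;;
     Write "t" "v" (Const 0)) ;;
  "p" ::= "src".["ps"] ;;
  "s" ::= "tgt".["ps"] ;;
  Write "t" "p" ("r".["s"] - "r".["p"] - Const 1) ;;
  Call "_" Init [:: Var "n"] ;;
  Call "_" Insert [:: Var "p"; "t".["p"]].

Definition relief_loop : cmd pq_op :=
  Call "empty" IsEmpty [::] ;;
  While ("empty" =? Const 0)
    (Call "u" PopMax [::] ;;
     Write "r'" "u" ("r'".["u"] + "t".["u"]) ;;
     For "i" ("outstart".["u"]) ("outstart".["u" + Const 1])
       ("e" ::= "out".["i"] ;;
        "v" ::= "tgt".["e"] ;;
        If ("F".["e"] =? Const 0)
          (If ("r'".["v"] <=? "r'".["u"])
             ("tnew" ::= "r'".["u"] + Const 1 - "r'".["v"] ;;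
              relax "v"))) ;;
     For "i" ("instart".["u"]) ("instart".["u" + Const 1])
       ("e" ::= "in".["i"] ;;
        "w" ::= "src".["e"] ;;
        If ("F".["e"] =? Const 1)
          (If (slack_expr "r" "w" "u" <? slack_expr "r'" "w" "u")
             ("tnew" ::= slack_expr "r'" "w" "u" - slack_expr "r" "w" "u" ;;
              relax "w"))) ;;
     Call "empty" IsEmpty [::]).

Definition relief_final : cmd pq_op :=
  If (Const 0 <? slack_expr "r'" "p" "s")
    (For "e" (Const 0) "m" (Write "O" "e" (Const 0)) ;;
     "x" ::= "s" ;;
     While (TNot ("x" =? "p"))
       (Write "O" ("pedge".["x"]) (Const 1) ;;
        "x" ::= "parent".["x"]) ;;
     For "e" (Const 0) "m"
       (If ("O".["e"] =? Const 1)
          (Write "F" "e" (Const 1 - "F".["e"]))) ;;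
     Write "F" "ps" (Const 0)).

Definition relief : cmd pq_op := relief_init ;; relief_loop ;; relief_final.

End Relief.

Section Encoding.
Variable V : finType.
Implicit Types (E H : {set V * V}) (r : V -> int) (u v : V) (e : V * V).

Definition vnum (v : V) : int := (enum_rank v : nat)%:Z.

Definition enum_at (st : store) (start list : string) (i : int)
    (s : seq int) : Prop :=
  let a := arr st start i in
  arr st start (i + 1) = a + (size s)%:Z /\
  perm_eq [seq arr st list (a + j%:Z) | j <- iota 0 (size s)] s.

(* The edges are numbered by their positions in [es], an arbitrary listing of
   [E]; the adjacency lists are in arbitrary order. *)
Record encodes E H r (ps : V * V) (es : seq (V * V)) (st : store) : Prop := {
  enc_uniq : uniq es;
  enc_mem : es =i E;
  enc_n : var st "n"%string = #|V|%:Z;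
  enc_m : var st "m"%string = #|E|%:Z;
  enc_ps : var st "ps"%string = (index ps es)%:Z;
  enc_r : forall v, arr st "r"%string (vnum v) = r v;
  enc_src : forall e, e \in E -> arr st "src"%string (index e es)%:Z = vnum e.1;
  enc_tgt : forall e, e \in E -> arr st "tgt"%string (index e es)%:Z = vnum e.2;
  enc_H : forall e, e \in E ->
    arr st "H"%string (index e es)%:Z = (e \in H : nat)%:Z;
  enc_out : forall u, enum_at st "outstart" "out" (vnum u)
    [seq (index e es)%:Z | e <- es & e.1 == u];
  enc_in : forall u, enum_at st "instart" "in" (vnum u)
    [seq (index e es)%:Z | e <- es & e.2 == u]
}.

End Encoding.

(* Main.v *)
Require Import Defs.
From Stdlib Require Import String.
From mathcomp Require Import all_boot all_order all_algebra zify.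
Set Implicit Arguments.
Unset Strict Implicit.
Unset Printing Implicit Defensive.

Import Order.TTheory GRing.Theory Num.Theory.
Local Open Scope ring_scope.

(** Every vertex is popped at most once.  Since [r] conforms [H], an edge outside
    [H] is forward, so a vertex [u] popped with priority [t] offers to unpopped
    vertices only priorities at most [t], and it offers nothing to vertices that
    were popped earlier with priority at least [t].  Hence priorities are popped in
    nonincreasing order, starting from the slack [D] of [(p, s)], each edge is
    scanned at most twice, and the parent of a popped vertex was popped strictly
    before it, so that the final walk from [s] to [p] has at most [n] steps.

    The queue is an array of buckets indexed by priority with a pointer [cur] to
    the highest bucket in use.  A change of priority leaves the old entry behind;
    an entry is stale when the current priority of its key is not the index of its
    bucket, and stale entries are discarded when they reach the top.  With the
    potential [cur + number of entries], every operation has constant amortised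
    cost, except that an insertion above [cur] also pays for the increase of
    [cur], which happens only at the first insertion, at cost [O(D)]. *)

(** * Execution with time credits *)

Section Credits.
Variables (P Q : Type) (ext : ext_sem P Q).
Implicit Types (c : cmd P) (st : store) (q : Q).
Implicit Types (Post : store -> Q -> nat -> Prop).

(* [N] is the number of time credits available before [c], and the last argument
   of [Post] the number of those left over. *)
Definition wp c st q (N : nat) Post : Prop :=
  exists st' q' k M,
    [/\ exec ext c st q st' q' k, (k + M = N)%N & Post st' q' M].

Lemma wp_mono c st q N (Post Post' : store -> Q -> nat -> Prop) :
  wp c st q N Post -> (forall st' q' M, Post st' q' M -> Post' st' q' M) ->
  wp c st q N Post'.
Proof.
by move=> [st' [q' [k [M [ex le post]]]]] imp; exists st', q', k, M; split; auto.
Qed.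

Lemma wp_assign x e st q N Post :
  (ecost e < N)%N ->
  (forall M, ((ecost e).+1 + M = N)%N ->
     Post (set_var st x (eval st e)) q M) ->
  wp (Assign x e) st q N Post.
Proof.
move=> leN post; exists (set_var st x (eval st e)), q, (ecost e).+1.
exists (N - (ecost e).+1)%N; split; [exact: ExecAssign | lia |].
apply: post; lia.
Qed.

Lemma wp_write a i e st q N Post :
  (ecost i + ecost e < N)%N ->
  (forall M, ((ecost i + ecost e).+1 + M = N)%N ->
     Post (set_arr st a (eval st i) (eval st e)) q M) ->
  wp (Write a i e) st q N Post.
Proof.
move=> leN post; exists (set_arr st a (eval st i) (eval st e)), q.
exists (ecost i + ecost e).+1, (N - (ecost i + ecost e).+1)%N.
split; [exact: ExecWrite | lia |].
apply: post; lia.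
Qed.

Lemma wp_seq c1 c2 st q N Post :
  wp c1 st q N (fun st' q' M => wp c2 st' q' M Post) ->
  wp (Seq c1 c2) st q N Post.
Proof.
move=> [st1 [q1 [k1 [M1 [ex1 le1 [st2 [q2 [k2 [M2 [ex2 le2 post]]]]]]]]]].
exists st2, q2, (k1 + k2)%N, M2; split=> //; last lia.
exact: ExecSeq ex1 ex2.
Qed.

Lemma wp_if b c st q N Post :
  (tcost b < N)%N ->
  (forall M, ((tcost b).+1 + M = N)%N -> holds st b -> wp c st q M Post) ->
  (forall M, ((tcost b).+1 + M = N)%N -> ~~ holds st b -> Post st q M) ->
  wp (If b c) st q N Post.
Proof.
move=> leN post_t post_f; have eqN := subnKC leN.
have [hb|hb] := boolP (holds st b).
  have [st1 [q1 [k1 [M1 [ex1 le1 post]]]]] := post_t _ eqN hb.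
  exists st1, q1, ((tcost b).+1 + k1)%N, M1; split=> //; last lia.
  exact: ExecIfTrue.
exists st, q, (tcost b).+1, (N - (tcost b).+1)%N; split; auto.
exact: ExecIfFalse.
Qed.

Lemma wp_while b c (I : nat -> store -> Q -> nat -> Prop) j st q N Post :
  I j st q N ->
  (forall j st q N, I j st q N -> (tcost b < N)%N) ->
  (forall j st q N M, I j st q N -> ((tcost b).+1 + M = N)%N -> holds st b ->
     wp c st q M (fun st' q' M' => exists2 j', (j' < j)%N & I j' st' q' M')) ->
  (forall j st q N M, I j st q N -> ((tcost b).+1 + M = N)%N ->
     ~~ holds st b -> Post st q M) ->
  wp (While b c) st q N Post.
Proof.
move=> I0 guard step done.
elim/ltn_ind: j => j IH in st q N I0 *.
have eqN := subnKC (guard _ _ _ _ I0).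
have [hb|hb] := boolP (holds st b).
  have [st1 [q1 [k1 [M1 [ex1 le1 [j' lt_j I1]]]]]] := step _ _ _ _ _ I0 eqN hb.
  have [st2 [q2 [k2 [M2 [ex2 le2 post]]]]] := IH j' lt_j _ _ _ I1.
  exists st2, q2, ((tcost b).+1 + k1 + k2)%N, M2; split=> //; last lia.
  exact: ExecWhileTrue ex1 ex2.
exists st, q, (tcost b).+1, (N - (tcost b).+1)%N; split; eauto.
exact: ExecWhileFalse.
Qed.

(** [I j] holds just before the test of round [j]. As [hi] is evaluated again at every test, the
    invariant has to supply its value each time; the 4 credits left by the body pay for incrementing
    the counter. *)
Lemma wp_for x lo hi c (a : int) (k : nat)
    (I : nat -> store -> Q -> nat -> Prop) st q N Post :
  eval st lo = a -> (ecost lo < N)%N ->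
  (forall M, ((ecost lo).+1 + M = N)%N -> I 0%N (set_var st x a) q M) ->
  (forall j st q N, I j st q N ->
     [/\ var st x = a + j%:Z, eval st hi = a + k%:Z & (ecost hi + 2 < N)%N]) ->
  (forall j st q N M, (j < k)%N -> I j st q N -> ((ecost hi).+3 + M = N)%N ->
     wp c st q M (fun st' q' M' =>
       [/\ (4 <= M')%N, var st' x = a + j%:Z &
         forall M'', (4 + M'' = M')%N ->
         I j.+1 (set_var st' x (a + j.+1%:Z)) q' M''])) ->
  (forall st q N M, I k st q N -> ((ecost hi).+3 + M = N)%N -> Post st q M) ->
  wp (For x lo hi c) st q N Post.
Proof.
move=> eq_a leN I0 facts step done.
apply: wp_seq; apply: wp_assign => // M eqM; rewrite eq_a.
(* The index required by [wp_while] is the number of remaining rounds. *)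
pose J i st q N := exists2 j : nat, (i + j = k)%N & I j st q N.
apply: (@wp_while _ _ J k).
- by exists 0%N; [lia | apply: I0].
- by move=> i st1 q1 N1 [j _ /facts[_ _]] /=; lia.
- move=> i st1 q1 N1 M1 [j eqk Ij] /= eqM1.
  have [eqx eqhi _] := facts _ _ _ _ Ij; rewrite eqx eqhi => ltjk.
  apply: wp_seq; apply: wp_mono (step j _ _ _ _ _ Ij _) _; [lia | lia |].
  move=> st' q' M' [leM' eqx' IS]; apply: wp_assign => //= M'' eqM''.
  rewrite eqx' (_ : a + j%:Z + 1 = a + j.+1%:Z); last lia.
  exists i.-1; first lia.
  exists j.+1; first lia.
  by apply: IS; lia.
- move=> i st1 q1 N1 M1 [j eqk Ij] /= eqM1.
  have [eqx eqhi _] := facts _ _ _ _ Ij; rewrite eqx eqhi => gejk.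
  have ejk : j = k by lia.
  by apply: done; [rewrite -ejk; exact: Ij | lia].
Qed.

Lemma wp_call x f es st q z q' k N Post :
  ext f (map (eval st) es) q z q' k ->
  ((sumn [seq (ecost e).+1 | e <- es]).+1 + k <= N)%N ->
  (forall M, ((sumn [seq (ecost e).+1 | e <- es]).+1 + k + M = N)%N ->
     Post (set_var st x z) q' M) ->
  wp (Call x f es) st q N Post.
Proof.
move=> ex leN post; exists (set_var st x z), q'.
exists ((sumn [seq (ecost e).+1 | e <- es]).+1 + k)%N.
exists (N - ((sumn [seq (ecost e).+1 | e <- es]).+1 + k))%N.
split; [exact: ExecCall | lia |].
by apply: post; lia.
Qed.

End Credits.

(** * Bucket queues *)

Definition upd (f : int -> int) (i z : int) : int -> int :=
  fun j => if i == j then z else f j.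

Section Program.
Local Open Scope string_scope.
Local Open Scope prog_scope.

(* Node [0] is a sentinel whose key [-1] has priority [0]: an empty bucket then
   looks like a stale one, except bucket [0], at which [bq_clean] stops. *)
Definition bq_init : cmd void :=
  "cur" ::= Const 0 ;;
  "cnt" ::= Const 0 ;;
  Write "head" (Const 0) (Const 0) ;;
  Write "key" (Const 0) (Const (-1)) ;;
  Write "prio" (Const (-1)) (Const 0).

Definition bq_insert : cmd void :=
  While ("cur" <? "t")
    ("cur" ::= "cur" + Const 1 ;;
     Write "head" "cur" (Const 0)) ;;
  Write "prio" "x" "t" ;;
  "cnt" ::= "cnt" + Const 1 ;;
  Write "key" "cnt" "x" ;;
  Write "next" "cnt" ("head".["t"]) ;;
  Write "head" "t" "cnt".

Definition bq_clean : cmd void :=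
  While (TNot ("prio".["key".["head".["cur"]]] =? "cur"))
    ("h" ::= "head".["cur"] ;;
     If ("h" =? Const 0) ("cur" ::= "cur" - Const 1) ;;
     If (TNot ("h" =? Const 0)) (Write "head" "cur" ("next".["h"]))).

Definition bq_is_empty : cmd void :=
  bq_clean ;;
  "z" ::= Const 0 ;;
  If ("cur" =? Const 0) ("z" ::= Const 1).

Definition bq_pop : cmd void :=
  bq_clean ;;
  "x" ::= "key".["head".["cur"]] ;;
  Write "prio" "x" (Const 0).

Definition bucket_queue : pq_impl := fun f =>
  match f with
  | Init => Proc [:: "n"] bq_init "cur"
  | Insert => Proc [:: "x"; "t"] bq_insert "cur"
  | IsEmpty => Proc [::] bq_is_empty "z"
  | PopMax => Proc [::] bq_pop "x"
  end.

End Program.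

(** A linked list of nodes starting at [h]. The bound by [cnt] keeps its nodes apart from node
    [cnt + 1], which the next insertion writes; node 0 ends the list. *)
Fixpoint chain (key next : int -> int) (cnt h : int) (l : seq int) : Prop :=
  if l is x :: l' then
    [/\ 0 < h <= cnt, key h = x & chain key next cnt (next h) l']
  else h = 0.

Lemma chain_ext key next cnt key' next' cnt' h l :
  (forall i, i <= cnt -> key' i = key i /\ next' i = next i) -> cnt <= cnt' ->
  chain key next cnt h l -> chain key' next' cnt' h l.
Proof.
move=> eqf le_cnt; elim: l h => //= x l IH h [/andP[h0 hc] kh ch].
have [-> ->] := eqf _ hc; split; [lia | by [] | exact: IH].
Qed.

(* [L b] lists the keys of the entries of bucket [b], valid or stale, and [N] is
   the number of all entries. *)
Record buckets (vcur cnt : int) (head key next prio : int -> int)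
    (c : contents) (cur N : nat) (L : nat -> seq int) : Prop := {
  b_cur : vcur = cur%:Z;
  b_cnt : 0 <= cnt;
  b_nil : L 0%N = [::];
  b_key0 : key 0 = -1;
  b_prio0 : prio (-1) = 0;
  b_chain : forall b, (b <= cur)%N -> chain key next cnt (head b%:Z) (L b);
  b_entry : forall b x, (b <= cur)%N -> x \in L b ->
    0 <= x /\ prio x = odflt 0 (c x);
  b_mem : forall x t, c x = Some t -> exists b : nat,
    [/\ t = b%:Z, (0 < b <= cur)%N & x \in L b];
  b_size : (\sum_(b < cur.+1) size (L b) = N)%N
}.

Definition bq_repr (c : contents) (cur N : nat) (st : store) : Prop :=
  exists L, buckets (var st "cur"%string) (var st "cnt"%string)
    (arr st "head"%string) (arr st "key"%string) (arr st "next"%string)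
    (arr st "prio"%string) c cur N L.

Ltac step :=
  cbv beta;
  match goal with
  | |- wp _ (Seq _ _) _ _ _ _ => apply: wp_seq; step
  | |- wp _ (Assign _ _) _ _ _ _ =>
      apply: wp_assign; [move=> /=; lia | move=> /= ? ?]
  | |- wp _ (Write _ _ _) _ _ _ _ =>
      apply: wp_write; [move=> /=; lia | move=> /= ? ?]
  | |- wp _ (If _ _) _ _ _ _ =>
      apply: wp_if; [move=> /=; lia | move=> /= ? ? | move=> /= ? ?]
  end.

(** Constant cost in uninitialised memory: only bucket 0 is set up, since a higher bucket is cleared
    whenever the pointer rises to it. *)
Lemma bq_init_spec args st : exists z st' k,
  [/\ pq_call bucket_queue Init args st z st' k, (k <= 20)%N &
      bq_repr (fun=> None) 0 0 st'].
Proof.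
pose Post st' (_ : unit) (_ : nat) := bq_repr (fun=> None) 0 0 st'.
have: wp no_ext bq_init (bind_params [:: "n"%string] args st) tt 20 Post.
  rewrite /bq_init; set st0 := bind_params _ _ _.
  do 5!step.
  exists (fun=> [::]); split=> //=.
  - by case.
  - by rewrite big_ord_recl big_ord0.
move=> [st' [[] [k [M [ex leM rep]]]]].
exists (var st' "cur"%string), st', k; split=> //; lia.
Qed.

(** * Elementary changes of the bucket structure *)

Lemma buckets_lower vcur cnt head key next prio c cur N L :
  buckets vcur cnt head key next prio c cur.+1 N L -> L cur.+1 = [::] ->
  buckets (vcur - 1) cnt head key next prio c cur N L.
Proof.
move=> [eqcur cnt0 L0 key0 prio0 ch entry mem sz] Lnil; split=> //.
- by rewrite eqcur; lia.
- by move=> b leb; apply: ch; lia.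
- by move=> b x leb; apply: entry; lia.
- move=> x t /mem[b [eqt leb xL]]; exists b; split=> //.
  have: b != cur.+1 by apply: contraTneq xL => ->; rewrite Lnil.
  lia.
- by move: sz; rewrite big_ord_recr /= Lnil addn0.
Qed.

Lemma buckets_raise vcur cnt head key next prio c cur N L :
  buckets vcur cnt head key next prio c cur N L ->
  exists L', buckets (vcur + 1) cnt (upd head (vcur + 1) 0) key next prio c
    cur.+1 N L'.
Proof.
move=> [eqcur cnt0 L0 key0 prio0 ch entry mem sz].
(* Nothing is known of [L] above [cur], so the bucket just entered is declared empty, in accordance
   with its cleared head. *)
exists (fun b => if (b <= cur)%N then L b else [::]); split=> //.
- by rewrite eqcur; lia.
- move=> b leb; rewrite /upd; case: (leqP b cur) => leb'.
    by rewrite ifF; [exact: ch | lia].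
  by rewrite ifT //; lia.
- by move=> b x; case: (leqP b cur) => // leb _; apply: entry.
- move=> x t /mem[b [eqt leb xL]]; exists b; split=> //; first lia.
  by rewrite ifT //; lia.
- rewrite big_ord_recr /= ltnn addn0 -sz; apply: eq_bigr => b _.
  by rewrite -ltnS ltn_ord.
Qed.

(** The dropped entry represents no queued key: if [x] had priority [cur] in [c], then [b_entry]
    would give [prio x] the same value. *)
Lemma buckets_skip vcur cnt head key next prio c cur N L x l :
  buckets vcur cnt head key next prio c cur N L -> L cur = x :: l ->
  prio x <> cur%:Z -> exists N' L', (N'.+1 = N)%N /\
  buckets vcur cnt (upd head vcur (next (head vcur))) key next prio c cur N' L'.
Proof.
move=> [eqcur cnt0 L0 key0 prio0 ch entry mem sz] eqL stale.
pose L' b := if b == cur then l else L b.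
exists (\sum_(b < cur.+1) size (L' b))%N, L'; split.
  rewrite -sz !big_ord_recr /= /L' eqxx eqL /= addnS; congr (_ + _).+1.
  by apply: eq_bigr => b _; rewrite ifF //; have := ltn_ord b; lia.
split=> //.
- by rewrite /L'; case: eqP => // e; move: eqL; rewrite -e L0.
- move=> b leb; rewrite /L' /upd eqcur eqz_nat [cur == b]eq_sym.
  have [_|_] := eqVneq b cur; last exact: ch.
  by have := ch cur (leqnn _); rewrite eqL /= => -[].
- move=> b y leb; rewrite /L'; case: eqP => [_|_] yl; last exact: entry yl.
  by apply: (entry cur); rewrite ?eqL ?inE ?yl ?orbT.
- move=> y t eqc; have [b [eqt leb yL]] := mem _ _ eqc; exists b; split=> //.
  rewrite /L'; case: eqP => // eb; move: yL; rewrite eb eqL inE.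
  case/orP=> // /eqP ey; case: stale.
  have [|_ ->] := entry cur x (leqnn _); first by rewrite eqL mem_head.
  by rewrite -ey eqc /= eqt eb.
Qed.

(** Node [cnt + 1] lies on no existing chain. Older entries of [x] stay in place; the single write
    to [prio] changes the priority that all of them are compared with. *)
Lemma buckets_insert vcur cnt head key next prio c cur N L x (t : nat) :
  buckets vcur cnt head key next prio c cur N L ->
  0 <= x -> (0 < t <= cur)%N ->
  exists L', buckets vcur (cnt + 1) (upd head t%:Z (cnt + 1))
    (upd key (cnt + 1) x) (upd next (cnt + 1) (head t%:Z)) (upd prio x t%:Z)
    (update c x (Some t%:Z)) cur N.+1 L'.
Proof.
move=> [eqcur cnt0 L0 key0 prio0 ch entry mem sz] x0 let_.
pose L' b := if b == t then x :: L b else L b.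
have entry' b y : y \in L' b -> y = x \/ y \in L b.
  by rewrite /L'; case: eqP => _; rewrite ?inE; [case/predU1P|]; auto.
have chain' b : (b <= cur)%N -> chain (upd key (cnt + 1) x)
    (upd next (cnt + 1) (head t%:Z)) (cnt + 1) (head b%:Z) (L b).
  move=> leb; apply: chain_ext (ch _ leb); last lia.
  by move=> i lei; rewrite /upd (_ : (cnt + 1 == i) = false); lia.
exists L'; split=> //.
- lia.
- by rewrite /L' ifF //; lia.
- by rewrite /upd ifF //; lia.
- by rewrite /upd ifF //; lia.
- move=> b leb; rewrite /L'; have [->|neb] := eqVneq b t; last first.
    by rewrite [upd head _ _ _]/upd ifF; [exact: chain' | lia].
  rewrite [upd head _ _ _]/upd eqxx /= /upd eqxx; split; [lia | by [] |].
  by apply: chain'; lia.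
- move=> b y leb /entry'; rewrite /upd /update.
  have [->|neyx] := eqVneq y x; first by [].
  case=> [eyx|yL]; first by rewrite eyx eqxx in neyx.
  exact: entry yL.
- move=> y t'; rewrite /update; have [->|_] := eqVneq y x.
    by case=> <-; exists t; rewrite /L' eqxx mem_head.
  move=> /mem[b [eqt leb yL]]; exists b; split=> //.
  by rewrite /L'; case: eqP; rewrite ?inE ?yL ?orbT.
- have lt_t : (t < cur.+1)%N by lia.
  rewrite (bigD1 (Ordinal lt_t)) //= {1}/L' eqxx /= -sz.
  rewrite [in RHS](bigD1 (Ordinal lt_t)) //= addSn; congr (_ + _).+1.
  by apply: eq_bigr => b; rewrite -val_eqE /L' /= => /negPf->.
Qed.

(** Queued keys lie in buckets 1 to [cur], so [cur = 0] means an empty queue. If [cur > 0], the top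
    bucket is not empty, for its head would be the sentinel, of priority 0; its first entry then has
    priority [cur], which bounds all others. *)
Lemma buckets_top vcur cnt head key next prio c cur N L :
  buckets vcur cnt head key next prio c cur N L ->
  prio (key (head vcur)) = vcur ->
  let x := key (head vcur) in
  if cur == 0%N then c =1 fun=> None else c x = Some cur%:Z /\ is_max_key c x.
Proof.
move=> [eqcur cnt0 L0 key0 prio0 ch entry mem sz]; rewrite eqcur => top /=.
have [ecur|ncur] := eqVneq cur 0%N.
  by move=> x; case eqc: (c x) => [t|//]; have [b []] := mem _ _ eqc; lia.
have := ch cur (leqnn _); case eqL: (L cur) => [|x l] /=.
  by move=> h0; move: top; rewrite h0 key0 prio0; lia.
move=> [_ ex _]; rewrite ex in top *.
have [|x0] := entry cur x (leqnn _); first by rewrite eqL mem_head.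
rewrite top; case eqc: (c x) => [t|] /=; last lia.
move=> ect; rewrite -ect in eqc *; split=> //; exists cur%:Z => //.
by move=> y t' /mem[b []]; lia.
Qed.

(** Queued priorities are positive, so priority 0 makes all entries of [x] stale while the lists
    stay as they are. *)
Lemma buckets_remove vcur cnt head key next prio c cur N L x :
  buckets vcur cnt head key next prio c cur N L -> 0 <= x ->
  buckets vcur cnt head key next (upd prio x 0) (update c x None) cur N L.
Proof.
move=> [eqcur cnt0 L0 key0 prio0 ch entry mem sz] x0; split=> //.
- by rewrite /upd ifF //; lia.
- move=> b y leb yL; rewrite /upd /update.
  have [->|neyx] := eqVneq y x; first by [].
  exact: entry yL.
- by move=> y t; rewrite /update; have [//|_ /mem] := eqVneq y x.
Qed.

(** * Amortised cost of the queue operations *)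

(** Each round lowers [cur] or discards an entry, and is paid for by the 30 credits this releases
    from the potential [30 * (cur + N)]; the constant 40 covers the last test. *)
Lemma bq_clean_spec c cur N st M :
  bq_repr c cur N st -> (30 * (cur + N) + 40 <= M)%N ->
  wp no_ext bq_clean st tt M (fun st' _ M' =>
    exists cur' N', [/\ bq_repr c cur' N' st',
      (30 * (cur' + N') + M <= M' + 30 * (cur + N) + 40)%N &
      arr st' "prio"%string (arr st' "key"%string
        (arr st' "head"%string (var st' "cur"%string))) =
      var st' "cur"%string]).
Proof.
move=> rep leM.
pose I j st' (_ : unit) M' := exists cur' N',
  [/\ j = (cur' + N')%N, bq_repr c cur' N' st' &
      (30 * (cur' + N') + M <= M' + 30 * (cur + N))%N].
rewrite /bq_clean; apply: (@wp_while _ _ _ _ _ I (cur + N)%N).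
- by exists cur, N; split=> //; lia.
- by move=> j st1 q1 M1 [cur' [N' [_ _ le1]]] /=; lia.
- move=> j st1 q1 M1 M2 [cur' [N' [-> [L bk] le1]]] /= eqM2 stale.
  have eqcur := b_cur bk.
  have ch := b_chain bk (leqnn _); rewrite -eqcur in ch.
  step; step => [hd0|hd0].
    case eqL: (L cur') ch => [|x l] /= ch; last by case: ch => ch _ _; lia.
    case: cur' => [|cur'] in bk eqL eqcur ch le1 *.
      (* An empty bucket 0 cannot look stale: the sentinel has priority 0, equal to the pointer. *)
      by move: stale; rewrite ch (b_key0 bk) (b_prio0 bk) eqcur.
    step; step => [|_]; first by rewrite (eqP hd0).
    exists (cur' + N')%N; first lia.
    exists cur', N'; split=> //; last lia.
    by exists L; exact: buckets_lower.
  case eqL: (L cur') ch => [|x l] /= ch; first by rewrite ch in hd0.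
  step => [_|]; last by rewrite hd0.
  have [_ eqx _] := ch.
  have [|N'' [L' [eqN bk']]] := buckets_skip bk eqL.
    by rewrite -eqx -eqcur; apply/eqP.
  step; exists (cur' + N'')%N; first lia.
  exists cur', N''; split=> //; last lia.
  by exists L'.
- move=> j st1 q1 M1 M2 [cur' [N' [_ rep1 le1]]] /= eqM2.
  rewrite negbK => /eqP top; exists cur', N'; split=> //; lia.
Qed.

(** The truncated difference [t - cur] counts the rounds that raise the pointer, so an insertion at
    or below the pointer has constant cost. *)
Lemma bq_insert_spec c cur N st x (t : nat) :
  bq_repr c cur N st -> 0 <= x -> (0 < t)%N -> exists z st' k,
  [/\ pq_call bucket_queue Insert [:: x; t%:Z] st z st' k,
      (k <= 15 * (t - cur) + 30)%N &
      bq_repr (update c x (Some t%:Z)) (maxn cur t) N.+1 st'].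
Proof.
move=> rep x0 t0.
pose Post st' (_ : unit) (_ : nat) :=
  bq_repr (update c x (Some t%:Z)) (maxn cur t) N.+1 st'.
pose I j st' (_ : unit) M := exists cur',
  [/\ j = (t - cur')%N, bq_repr c cur' N st',
      maxn cur t = maxn cur' t, (15 * (t - cur') + 30 <= M)%N &
      var st' "x"%string = x /\ var st' "t"%string = t%:Z].
have: wp no_ext bq_insert (bind_params [:: "x"%string; "t"%string]
    [:: x; t%:Z] st) tt (15 * (t - cur) + 30) Post.
  rewrite /bq_insert; apply: wp_seq.
  apply: (@wp_while _ _ _ _ _ I (t - cur)%N).
  - by exists cur; split.
  - by move=> j st1 q1 M1 [cur' [_ _ _ le1 _]] /=; lia.
  - move=> j st1 q1 M1 M2 [cur' [-> [L bk] eqmax le1 [eqx eqt]]] /= eqM2.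
    rewrite eqt (b_cur bk) => lt_t; do 2!step.
    exists (t - cur'.+1)%N; first lia.
    exists cur'.+1; split=> //=; [|lia..].
    have [L' bk'] := buckets_raise bk; exists L'.
    exact: bk'.
  - move=> j st1 q1 M1 M2 [cur' [_ [L bk] eqmax le1 [eqx eqt]]] /= eqM2.
    rewrite eqt (b_cur bk) => lt_t; do 5!step.
    rewrite eqx eqt /Post eqmax (maxn_idPl _); last lia.
    by apply: buckets_insert; [exact: bk | | lia].
move=> [st' [[] [k [M [ex leM rep']]]]].
exists (var st' "cur"%string), st', k; split=> //; lia.
Qed.

Lemma inhabited_some (c : contents) x t : c x = Some t -> inhabited_pq c.
Proof. by move=> eqc; exists x; rewrite eqc. Qed.

Lemma inhabited_top c cur N st :
  bq_repr c cur N st ->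
  arr st "prio"%string (arr st "key"%string
    (arr st "head"%string (var st "cur"%string))) = var st "cur"%string ->
  (var st "cur"%string == 0) = ~~ (0 < cur)%N /\
  ((0 < cur)%N <-> inhabited_pq c).
Proof.
move=> [L bk] top; have := buckets_top bk top; rewrite (b_cur bk) eqz_nat /=.
have [->|ncur] := eqVneq cur 0%N.
  by move=> c0; split=> //; split=> // -[x]; rewrite c0.
move=> [eqc _]; split; first by rewrite lt0n ncur.
by split=> [_|_]; [exact: inhabited_some eqc | rewrite lt0n].
Qed.

Lemma bq_is_empty_spec c cur N st :
  bq_repr c cur N st -> exists z st' k cur' N',
  [/\ pq_call bucket_queue IsEmpty [::] st z st' k, bq_repr c cur' N' st',
      z = (cur' == 0%N : nat)%:Z, (0 < cur')%N <-> inhabited_pq c &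
      (k + 30 * (cur' + N') <= 30 * (cur + N) + 50)%N].
Proof.
move=> rep.
pose Post st' (_ : unit) (M : nat) := exists cur' N', 
  [/\ bq_repr c cur' N' st', var st' "z"%string = (cur' == 0%N : nat)%:Z,
      (0 < cur')%N <-> inhabited_pq c & (30 * (cur' + N') <= M)%N].
have: wp no_ext bq_is_empty (bind_params [::] [::] st) tt
    (30 * (cur + N) + 50) Post.
  rewrite /bq_is_empty; apply: wp_seq.
  apply: wp_mono (bq_clean_spec (M := (30 * (cur + N) + 50)%N) rep _) _.
    by lia.
  move=> st1 q1 M1 [cur' [N' [rep1 le1 top]]].
  have [eq0 inh] := inhabited_top rep1 top.
  step; step => [eqc|neqc].
    step; exists cur', N'; split=> //; first by rewrite /=; lia.
    by lia.
  exists cur', N'; split=> //; first by rewrite /=; lia.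
  by lia.
move=> [st' [[] [k [M [ex leM [cur' [N' [rep' eqz inh le]]]]]]]].
exists (var st' "z"%string), st', k, cur', N'; split=> //; lia.
Qed.

Lemma bq_pop_spec c cur N st :
  bq_repr c cur N st -> inhabited_pq c -> exists x st' k cur' N',
  [/\ pq_call bucket_queue PopMax [::] st x st' k,
      bq_repr (update c x None) cur' N' st', c x = Some cur'%:Z,
      is_max_key c x &
      (k + 30 * (cur' + N') <= 30 * (cur + N) + 50)%N].
Proof.
move=> rep inhc.
pose Post st' (_ : unit) (M : nat) := exists cur' N',
  let x := var st' "x"%string in
  [/\ bq_repr (update c x None) cur' N' st', c x = Some cur'%:Z,
      is_max_key c x & (30 * (cur' + N') <= M)%N].
have: wp no_ext bq_pop (bind_params [::] [::] st) tt
    (30 * (cur + N) + 50) Post.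
  rewrite /bq_pop; apply: wp_seq.
  apply: wp_mono (bq_clean_spec (M := (30 * (cur + N) + 50)%N) rep _) _.
    by lia.
  move=> st1 q1 M1 [cur' [N' [rep1 le1 top]]].
  have [_ inh] := inhabited_top rep1 top; move/inh: inhc => cur0.
  have [L bk] := rep1; have := buckets_top bk top.
  rewrite /= ifF; last lia.
  (* The popped entry stays behind as a stale one, hence [N'] does not drop. The pointer remains at
     the popped priority. *)
  move=> [eqc maxc]; do 2!step; exists cur', N'; split=> //=; last lia.
  exists L; apply: buckets_remove => //.
  have [b [_ leb xL]] := b_mem bk eqc.
  by have [] := b_entry bk (x := _) (b := b) _ xL; first lia.
move=> [st' [[] [k [M [ex leM [cur' [N' [rep' eqc maxc le]]]]]]]].
exists (var st' "x"%string), st', k, cur', N'; split=> //; lia.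
Qed.

Lemma bucket_queue_correct : pq_correct bucket_queue.
Proof.
(* Correctness hides the pointer and the number of entries, which matter for the cost only. *)
exists (fun _ c st => exists cur N, bq_repr c cur N st); split.
- move=> n st; have [z [st' [k [call _ rep]]]] := bq_init_spec [:: n%:Z] st.
  by exists z, st', k; split=> //; exists 0%N, 0%N.
- move=> n c st x t [cur [N rep]] /andP[x0 _] t0.
  case: t t0 => // t t0.
  have [z [st' [k [call _ rep']]]] := bq_insert_spec rep x0 t0.
  by exists z, st', k; split=> //; exists (maxn cur t), N.+1.
- move=> n c st [cur [N rep]].
  have [z [st' [k [cur' [N' [call rep' eqz inh _]]]]]] := bq_is_empty_spec rep.
  exists z, st', k; split=> //; first by exists cur', N'.
  rewrite -inh eqz; case: (cur') => //=; split=> // nlt; exfalso; exact: nlt.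
- move=> n c st [cur [N rep]] inh.
  have [x [st' [k [cur' [N' [call rep' _ maxc _]]]]]] := bq_pop_spec rep inh.
  by exists x, st', k; split=> //; exists cur', N'.
Qed.

(** * Relief *)

Lemma vnum_inj (V : finType) : injective (@vnum V).
Proof. by move=> u v [] /ord_inj/enum_rank_inj. Qed.

Lemma vnum_ltn (V : finType) (v : V) : (enum_rank v < #|V|)%N.
Proof. exact: ltn_ord. Qed.

(** Degree count: with [f] the source or the target of an edge, the degrees sum to the number of
    edges. *)
Lemma sum_count_fiber (T : Type) (V : finType) (f : T -> V) (s : seq T) :
  (\sum_v count (fun x => f x == v) s = size s)%N.
Proof.
elim: s => [|x s IH] /=; first by rewrite big1.
rewrite big_split /= IH (bigD1 (f x)) //= eqxx big1 // => v.
by rewrite eq_sym => /negPf->.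
Qed.

Section Run.
Variables (V : finType) (E H : {set V * V}) (r : V -> int) (p s : V).
Variable es : seq (V * V).
Hypothesis subH : H \subset E.
Hypothesis conf : conforms E H r.
Hypothesis psH : (p, s) \in H.
Variable Delta : nat.
Hypothesis Delta0 : (0 < Delta)%N.
Hypothesis eqDelta : r s - r p - 1 = Delta%:Z.

(* The positions where the adjacency lists of a vertex start. *)
Variables outpos inpos : V -> int.

Implicit Types (u v w : V) (S : {set V}) (st : store) (c : contents).

Let idx (e : V * V) : int := (index e es)%:Z.
Let dout u : nat := count (fun e => e.1 == u) es.
Let din u : nat := count (fun e => e.2 == u) es.

(** Stated for values and arrays instead of a store, so that it is preserved by computation alone
    when other names are written. *)
Record inputs (n m pse : int)
    (rk src tgt Hb outs out ins inn : int -> int) : Prop := {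
  in_n : n = #|V|%:Z;
  in_m : m = #|E|%:Z;
  in_size : size es = #|E|;
  in_mem : es =i E;
  in_ps : pse = idx (p, s);
  in_r : forall v, rk (vnum v) = r v;
  in_src : forall e, e \in E -> src (idx e) = vnum e.1;
  in_tgt : forall e, e \in E -> tgt (idx e) = vnum e.2;
  in_H : forall e, e \in E -> Hb (idx e) = (e \in H : nat)%:Z;
  in_outs : forall u, outs (vnum u) = outpos u;
  in_oute : forall u, outs (vnum u + 1) = outpos u + (dout u)%:Z;
  in_out : forall u j, (j < dout u)%N ->
    exists2 v, (u, v) \in E & out (outpos u + j%:Z) = idx (u, v);
  in_ins : forall u, ins (vnum u) = inpos u;
  in_ine : forall u, ins (vnum u + 1) = inpos u + (din u)%:Z;
  in_in : forall u j, (j < din u)%N ->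
    exists2 w, (w, u) \in E & inn (inpos u + j%:Z) = idx (w, u)
}.

Definition stored st : Prop :=
  inputs (var st "n"%string) (var st "m"%string) (var st "ps"%string)
    (arr st "r"%string) (arr st "src"%string) (arr st "tgt"%string)
    (arr st "H"%string) (arr st "outstart"%string) (arr st "out"%string)
    (arr st "instart"%string) (arr st "in"%string).

Lemma enum_at_nth st start list i (l : seq int) j :
  enum_at st start list i l -> (j < size l)%N ->
  arr st list (arr st start i + j%:Z) \in l.
Proof.
move=> [_ /perm_mem <-] ltj; apply/mapP; exists j => //.
by rewrite mem_iota.
Qed.

Lemma encodes_stored st :
  (forall u, arr st "outstart"%string (vnum u) = outpos u) ->
  (forall u, arr st "instart"%string (vnum u) = inpos u) ->
  encodes E H r (p, s) es st -> stored st.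
Proof.
move=> eqout eqin.
case=> uniq_es mem_es n_ m_ ps_ r_ src_ tgt_ H_ out_ in_; split=> //.
- by rewrite -(card_uniqP uniq_es); apply: eq_card.
- by move=> u; have [-> _] := out_ u; rewrite eqout size_map size_filter.
- move=> u j ltj; have := enum_at_nth (j := j) (out_ u).
  rewrite eqout size_map size_filter => /(_ ltj) /mapP[[u' v]].
  by rewrite mem_filter mem_es /= => /andP[/eqP -> euv] ->; exists v.
- by move=> u; have [-> _] := in_ u; rewrite eqin size_map size_filter.
- move=> u j ltj; have := enum_at_nth (j := j) (in_ u).
  rewrite eqin size_map size_filter => /(_ ltj) /mapP[[w u']].
  by rewrite mem_filter mem_es /= => /andP[/eqP -> euv] ->; exists w.
Qed.

(** * Invariant of the pops and offers *)

(* [S] is the set of popped vertices, [tau] the last priority popped, [d] the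
   order of the pops, and [c] the contents of the queue. *)
Record core (F rr tt par : int -> int) S (tau : int) (d : V -> nat) c : Prop := {
  core_F : forall e, e \in E -> F (idx e) = (e \in H : nat)%:Z;
  core_ge0 : forall v, 0 <= tt (vnum v);
  core_p : Delta%:Z <= tt (vnum p);
  core_in : forall v, v \in S ->
    rr (vnum v) = r v + tt (vnum v) /\ tau <= tt (vnum v);
  core_notin : forall v, v \notin S ->
    rr (vnum v) = r v /\ tt (vnum v) <= tau;
  core_queue : forall v, c (vnum v) =
    if (v \notin S) && (0 < tt (vnum v)) then Some (tt (vnum v)) else None;
  core_keys : forall x t, c x = Some t -> exists v, x = vnum v;
  core_order : forall v, v \in S -> (d v < #|S|)%N;
  core_parent : forall v, v \in S -> v = p \/
    exists y, [/\ y \in S, par (vnum v) = vnum y & (d y < d v)%N];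
  core_offer : forall v, v \notin S -> 0 < tt (vnum v) -> v = p \/
    exists2 y, y \in S & par (vnum v) = vnum y
}.

(** The maximum [t] of the queue bounds the priorities of all unpopped vertices and is at most the
    old [tau], so it can replace [tau]. The new vertex gets position [#|S|], above all earlier
    ones. *)
Lemma core_pop F rr tt par S tau d c x t :
  core F rr tt par S tau d c -> is_max_key c x -> c x = Some t ->
  exists u, [/\ x = vnum u, u \notin S, tt (vnum u) = t &
    core F (upd rr (vnum u) (rr (vnum u) + tt (vnum u))) tt par (u |: S) t
      (fun v => if v == u then #|S| else d v) (update c x None)].
Proof.
move=> K [t1 eqt1 maxx] eqt.
have et1 : t1 = t by move: eqt1; rewrite eqt => -[].
rewrite {}et1 {t1 eqt1} in maxx.
have [u eqx] := core_keys K eqt; exists u.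
move: eqt; rewrite eqx (core_queue K) => eqt; move: eqt.
case: ifP => // /andP[uS tu0] [eqt].
have le_t v : v \notin S -> tt (vnum v) <= t.
  move=> vS; have := maxx (vnum v) (tt (vnum v)); rewrite (core_queue K) vS /=.
  case: ltP => [_ /(_ erefl) //|le0 _]; lia.
have vneq v : v != u -> (vnum u == vnum v) = false.
  by move=> ne; apply/eqP => /vnum_inj euv; rewrite euv eqxx in ne.
have [ru tu] := core_notin K uS.
split=> //; split; try by case: K.
- move=> v; rewrite /upd !inE; have [-> _|ne /= vS] := eqVneq v u.
    by rewrite eqxx ru eqt.
  by rewrite vneq //; have [-> tv] := core_in K vS; split=> //; lia.
- move=> v; rewrite /upd !inE; have [->|ne /= vS] := eqVneq v u; first by [].
  by rewrite vneq //; have [-> _] := core_notin K vS; split=> //; exact: le_t.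
- move=> v; rewrite /update !inE; have [->|ne] := eqVneq v u.
    by rewrite eqxx.
  by rewrite eq_sym vneq //= (core_queue K).
- move=> y t'; rewrite /update; case: eqP => // _; exact: (core_keys K).
- move=> v; rewrite !inE cardsU1 uS; have [-> _|ne /= vS] := eqVneq v u.
    by rewrite add1n.
  by have := core_order K vS; lia.
(* The parent of [u] was recorded by an offer from a popped vertex, whose position is below
   [#|S|]. *)
- have par_in v y : y \in S -> par (vnum v) = vnum y -> v = p \/
      exists y, [/\ y \in u |: S, par (vnum v) = vnum y &
      ((if y == u then #|S| else d y) < #|S|)%N].
    move=> yS eqy; right; exists y; split=> //; first by rewrite !inE yS orbT.
    by rewrite ifF; [exact: (core_order K yS) | apply: contraNF uS => /eqP <-].
  move=> v; rewrite in_setU1; have [eu _|ne /= vS] := eqVneq v u.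
    have vS : v \notin S by rewrite eu.
    have tv : 0 < tt (vnum v) by rewrite eu.
    have [vp|[y yS eqy]] := core_offer K vS tv; first by left.
    exact: par_in eqy.
  have [|[y [yS eqy lt]]] := core_parent K vS; first by left.
  right; exists y; split=> //; first by rewrite !inE yS orbT.
  by rewrite ifF //; apply: contraNF uS => /eqP <-.
- move=> v; rewrite !inE negb_or => /andP[ne vS] tv.
  have [|[y yS eqy]] := core_offer K vS tv; first by left.
  by right; exists y => //; rewrite !inE yS orbT.
Qed.

Lemma core_relax F rr tt par S tau d c u v z :
  core F rr tt par S tau d c -> u \in S -> v \notin S ->
  tt (vnum v) < z -> z <= tau ->
  core F rr (upd tt (vnum v) z) (upd par (vnum v) (vnum u)) S tau d
    (update c (vnum v) (Some z)).
Proof.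
move=> K uS vS lt_z le_z; have v0 := core_ge0 K v.
have vneq w : w \in S -> (vnum v == vnum w) = false.
  by move=> wS; apply: contraNF vS => /eqP/vnum_inj->.
split; try by case: K.
- by move=> w; rewrite /upd; case: eqP => _; [lia | exact: (core_ge0 K w)].
- rewrite /upd; case: eqP => [e|_]; last exact: (core_p K).
  by have := core_p K; rewrite -e; lia.
- by move=> w wS; rewrite /upd vneq //; exact: (core_in K wS).
- move=> w wS; have [-> lew] := core_notin K wS; split=> //.
  by rewrite /upd; case: eqP.
- move=> w; rewrite /upd /update eq_sym; case: eqP => [/vnum_inj <-|_].
    by rewrite vS ifT //; lia.
  exact: (core_queue K w).
- move=> y t; rewrite /update; case: eqP => [-> _|_]; first by exists v.
  exact: (core_keys K).
- by move=> w wS; rewrite /upd vneq //; exact: (core_parent K wS).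
- move=> w wS; rewrite /upd; case: eqP => [_ _|_]; first by right; exists u.
  exact: (core_offer K wS).
Qed.

Lemma notin_forward e : e \in E -> e \notin H -> r e.1 < r e.2.
Proof.
by move=> eE; apply: contraNT; rewrite -leNgt => le_r; apply: conf.
Qed.

(** Here [r u < r v], by conformity. A popped [v] has risen by at least [tau], the rise of [u], and
    is still above [u]; an unpopped [v] has not moved, so the offer is at most [tau]. *)
Lemma core_out_edge F rr tt par S tau d c u v :
  core F rr tt par S tau d c -> u \in S -> tt (vnum u) = tau ->
  (u, v) \in E -> F (idx (u, v)) = 0 -> rr (vnum v) <= rr (vnum u) ->
  v \notin S /\ 0 < rr (vnum u) + 1 - rr (vnum v) <= tau.
Proof.
move=> K uS eqt uvE; rewrite (core_F K uvE) => eqF.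
have uvH : (u, v) \notin H by move: eqF; case: (_ \in H).
have /= lt_r := notin_forward uvE uvH; have [-> _] := core_in K uS.
have [vS|vS] := boolP (v \in S).
  by have [-> tv] := core_in K vS; lia.
by have [-> tv] := core_notin K vS; split=> //; lia.
Qed.

(** A popped [w] has risen at least as much as [u], so the slack cannot have grown. If [w] has not
    moved, the slack grows by at most the rise [tau] of [u]. *)
Lemma core_in_edge F rr tt par S tau d c u w :
  core F rr tt par S tau d c -> u \in S -> tt (vnum u) = tau ->
  let old := Num.max (r u - r w - 1) 0 in
  let new := Num.max (rr (vnum u) - rr (vnum w) - 1) 0 in
  old < new -> w \notin S /\ 0 < new - old <= tau.
Proof.
move=> K uS eqt /=; have [-> _] := core_in K uS.
have [wS|wS] := boolP (w \in S).
  by have [-> tw] := core_in K wS; lia.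
by have [-> tw] := core_notin K wS; split=> //; lia.
Qed.

(** * Scanning the edges at a popped vertex *)

Definition running st S tau d c : Prop :=
  [/\ stored st, var st "p"%string = vnum p, var st "s"%string = vnum s &
      core (arr st "F"%string) (arr st "r'"%string) (arr st "t"%string)
        (arr st "parent"%string) S tau d c].

(* While [u], just popped with priority [tau], is being scanned, the queue pointer
   stays at [tau]; [30] credits are kept for each entry of the queue, and [B] are
   left for the remaining work. *)
Definition scanning st q S (tau : nat) d u (B M : nat) : Prop :=
  [/\ u \in S, var st "u"%string = vnum u,
      arr st "t"%string (vnum u) = tau%:Z &
      exists c N, [/\ running st S tau d c, bq_repr c tau N q &
        (30 * N + B <= M)%N]].

#[local] Arguments String.eqb : simpl nomatch.

(** Since the offer is at most [tau], the insertion does not move the pointer: the 90 credits cover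
    its constant cost, the other instructions and the 30 credits kept for the new entry. The
    condition on [x] protects it from the dummy variable assigned by the call. *)
Lemma relax_spec x st q M S tau d u v B :
  String.eqb "_" x = false -> scanning st q S tau d u (B + 90) M ->
  var st x = vnum v -> v \notin S -> 0 < var st "tnew"%string <= tau%:Z ->
  wp (pq_call bucket_queue) (relax x) st q M (fun st' q' M' =>
    var st' "i"%string = var st "i"%string /\
    scanning st' q' S tau d u B M').
Proof.
move=> neq [uS equ eqt [c [N [run rep leM]]]] eqx vS bnd.
rewrite /relax; step => lt_t; last first.
  by split=> //; split=> //; exists c, N; split=> //; lia.
step.
case eqz: (var st "tnew"%string) bnd => [z|//] bnd.
have v0 : 0 <= vnum v by [].
have z0 : (0 < z)%N by lia.
have [y [q' [k [call lek rep']]]] := bq_insert_spec rep v0 z0.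
rewrite (maxn_idPl _) in rep'; last lia.
apply: wp_seq; apply: wp_call => /=; first by rewrite eqx eqz; exact: call.
  by lia.
move=> M1 eqM1; do 2!step.
split=> //; have uv : (vnum v == vnum u) = false.
  by apply: contraNF vS => /eqP/vnum_inj->.
split=> //=; first by rewrite eqx uv.
exists (update c (vnum v) (Some z%:Z)), N.+1; split=> //; last lia.
have [sto eqp eqs K] := run; split=> //=.
rewrite neq eqx equ; apply: core_relax => //; last by lia.
by move: lt_t; rewrite eqx eqz.
Qed.

Section Scans.
Local Open Scope string_scope.
Local Open Scope prog_scope.

(** The two scans of the loop body are named so that each has its own specification. *)
Definition out_scan : cmd pq_op :=
  For "i" ("outstart".["u"]) ("outstart".["u" + Const 1])
    ("e" ::= "out".["i"] ;;
     "v" ::= "tgt".["e"] ;;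
     If ("F".["e"] =? Const 0)
       (If ("r'".["v"] <=? "r'".["u"])
          ("tnew" ::= "r'".["u"] + Const 1 - "r'".["v"] ;;
           relax "v"))).

Definition in_scan : cmd pq_op :=
  For "i" ("instart".["u"]) ("instart".["u" + Const 1])
    ("e" ::= "in".["i"] ;;
     "w" ::= "src".["e"] ;;
     If ("F".["e"] =? Const 1)
       (If (slack_expr "r" "w" "u" <? slack_expr "r'" "w" "u")
          ("tnew" ::= slack_expr "r'" "w" "u" - slack_expr "r" "w" "u" ;;
           relax "w"))).

End Scans.

Lemma scanning_credits st q S tau d u B M B' M' :
  scanning st q S tau d u B M -> (M + B' <= M' + B)%N ->
  scanning st q S tau d u B' M'.
Proof.
move=> [uS equ eqt [c [N [run rep leM]]]] le; split=> //.
by exists c, N; split=> //; lia.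
Qed.

Lemma out_scan_spec st q S tau d u B M :
  scanning st q S tau d u (B + 160 * dout u + 20) M ->
  wp (pq_call bucket_queue) out_scan st q M (fun st' q' M' =>
    scanning st' q' S tau d u B M').
Proof.
move=> sc.
pose I j st' q' M' := var st' "i"%string = outpos u + j%:Z /\
  scanning st' q' S tau d u (B + 160 * (dout u - j) + 10) M'.
rewrite /out_scan; apply: (@wp_for _ _ _ _ _ _ _ (outpos u) (dout u) I).
- have [_ equ _ [c [N [[sto _ _ _] _ _]]]] := sc.
  by rewrite /= equ (in_outs sto).
- by have [_ _ _ [c [N [_ _ leM]]]] := sc; move=> /=; lia.
- move=> M1 eqM1; split; first by rewrite /= addr0.
  by apply: scanning_credits sc _; move: eqM1 => /=; lia.
- move=> j st1 q1 M1 [eqi [_ equ _ [c [N [[sto _ _ _] _ leM]]]]].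
  by split=> //=; [rewrite equ (in_oute sto) | lia].
- move=> j st1 q1 M1 M2 ltj [eqi sc1] /= eqM2.
  have [uS equ eqt [c [N [[sto eqp eqs K] rep leM]]]] := sc1.
  have [v uvE eqout] := in_out sto ltj.
  do 2!step.
  rewrite eqi eqout (in_tgt sto uvE) /=.
  set st2 := set_var (set_var st1 _ _) _ _.
  (* Common postcondition of all branches; 14 is the 10 of the invariant plus 4 for the counter. *)
  pose ok st' q' M' := var st' "i"%string = outpos u + j%:Z /\
    scanning st' q' S tau d u (B + 160 * (dout u - j.+1) + 14) M'.
  apply: (@wp_mono _ _ _ _ _ _ _ ok); last first.
    move=> st' q' M' [eqi' sc']; split=> //.
      by have [_ _ _ [c' [N' [_ _ leM']]]] := sc'; lia.
    move=> M'' eqM''; split=> //; apply: scanning_credits sc' _; lia.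
  step => [F0|_]; last by split=> //; apply: scanning_credits sc1 _; lia.
  step => [le_r|_]; last by split=> //; apply: scanning_credits sc1 _; lia.
  rewrite equ in le_r.
  have [vS bnd] := core_out_edge K uS eqt uvE (eqP F0) le_r.
  step; apply: wp_mono (relax_spec (v := v)
    (B := (B + 160 * (dout u - j.+1) + 14)%N) _ _ _ vS _) _ => //=.
  + by apply: scanning_credits sc1 _; lia.
  + by rewrite equ.
  + by move=> st' q' M' [eqi' sc']; split; first rewrite eqi'.
- move=> st1 q1 M1 M2 [_ sc1] /= eqM2; apply: scanning_credits sc1 _; lia.
Qed.

Lemma in_scan_spec st q S tau d u B M :
  scanning st q S tau d u (B + 160 * din u + 20) M ->
  wp (pq_call bucket_queue) in_scan st q M (fun st' q' M' =>
    scanning st' q' S tau d u B M').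
Proof.
move=> sc.
pose I j st' q' M' := var st' "i"%string = inpos u + j%:Z /\
  scanning st' q' S tau d u (B + 160 * (din u - j) + 10) M'.
rewrite /in_scan; apply: (@wp_for _ _ _ _ _ _ _ (inpos u) (din u) I).
- have [_ equ _ [c [N [[sto _ _ _] _ _]]]] := sc.
  by rewrite /= equ (in_ins sto).
- by have [_ _ _ [c [N [_ _ leM]]]] := sc; move=> /=; lia.
- move=> M1 eqM1; split; first by rewrite /= addr0.
  by apply: scanning_credits sc _; move: eqM1 => /=; lia.
- move=> j st1 q1 M1 [eqi [_ equ _ [c [N [[sto _ _ _] _ leM]]]]].
  by split=> //=; [rewrite equ (in_ine sto) | lia].
- move=> j st1 q1 M1 M2 ltj [eqi sc1] /= eqM2.
  have [uS equ eqt [c [N [[sto eqp eqs K] rep leM]]]] := sc1.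
  have [w wuE eqin] := in_in sto ltj.
  do 2!step.
  rewrite eqi eqin (in_src sto wuE) /=.
  set st2 := set_var (set_var st1 _ _) _ _.
  pose ok st' q' M' := var st' "i"%string = inpos u + j%:Z /\
    scanning st' q' S tau d u (B + 160 * (din u - j.+1) + 14) M'.
  apply: (@wp_mono _ _ _ _ _ _ _ ok); last first.
    move=> st' q' M' [eqi' sc']; split=> //.
      by have [_ _ _ [c' [N' [_ _ leM']]]] := sc'; lia.
    move=> M'' eqM''; split=> //; apply: scanning_credits sc' _; lia.
  step => [F0|_]; last by split=> //; apply: scanning_credits sc1 _; lia.
  step => [lt_r|_]; last by split=> //; apply: scanning_credits sc1 _; lia.
  rewrite equ !(in_r sto) in lt_r.
  have [wS bnd] := core_in_edge K uS eqt lt_r.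
  step; apply: wp_mono (relax_spec (v := w)
    (B := (B + 160 * (din u - j.+1) + 14)%N) _ _ _ wS _) _ => //=.
  + by apply: scanning_credits sc1 _; lia.
  + by rewrite equ !(in_r sto).
  + by move=> st' q' M' [eqi' sc']; split; first rewrite eqi'.
- move=> st1 q1 M1 M2 [_ sc1] /= eqM2; apply: scanning_credits sc1 _; lia.
Qed.

(** * The walk along parent links and the final update *)

Section Trace.
Local Open Scope string_scope.
Local Open Scope prog_scope.

Definition trace : cmd pq_op :=
  While (TNot ("x" =? "p"))
    (Write "O" ("pedge".["x"]) (Const 1) ;;
     "x" ::= "parent".["x"]).

End Trace.

(** A popped vertex other than [p] has a parent popped earlier, so [d] decreases along the walk and
    bounds its number of steps. *)
Lemma trace_spec st q S tau d c v M B :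
  running st S tau d c -> var st "x"%string = vnum v -> v \in S ->
  (20 * d v + 10 + B <= M)%N ->
  wp (pq_call bucket_queue) trace st q M (fun st' q' M' =>
    running st' S tau d c /\ (B <= M')%N).
Proof.
move=> run eqx vS leM.
pose I j st' (_ : store) M' := exists v, [/\ j = d v, v \in S,
  var st' "x"%string = vnum v, running st' S tau d c &
  (20 * d v + 10 + B <= M')%N].
rewrite /trace; apply: (@wp_while _ _ _ _ _ I (d v)).
- by exists v.
- by move=> j st1 q1 M1 [w [_ _ _ _ leM1]] /=; lia.
- move=> j st1 q1 M1 M2 [w [-> wS eqw run1 leM1]] /= eqM2.
  have [sto eqp eqs K] := run1.
  rewrite eqw eqp => /negP ne.
  have [ewp|[y [yS eqy lt]]] := core_parent K wS.
    by rewrite ewp eqxx in ne.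
  do 2!step; exists (d y) => //; exists y; split=> //; last lia.
  by rewrite /= eqw.
- move=> j st1 q1 M1 M2 [w [_ _ _ run1 leM1]] /= eqM2 _; split=> //; lia.
Qed.

Lemma relief_final_spec st q S tau d c M :
  running st S tau d c -> (forall x, c x = None) ->
  (20 * #|V| + 40 * #|E| + 100 <= M)%N ->
  wp (pq_call bucket_queue) relief_final st q M (fun _ _ _ => True).
Proof.
move=> run c0 leM; have [sto eqp eqs K] := run.
rewrite /relief_final; step; rewrite eqp eqs => slack0; last by [].
have in_S v : 0 < arr st "t"%string (vnum v) -> v \in S.
  move=> tv; have := core_queue K v; rewrite c0 tv andbT.
  by case: (v \in S).
have pS : p \in S by apply: in_S; have := core_p K; lia.
(* Otherwise [s] keeps its rank while [p] has risen by at least [Delta], which leaves no slack on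
   the edge. *)
have sS : s \in S.
  have [rp _] := core_in K pS; have := core_p K.
  have [//|sN] := boolP (s \in S); have [rs _] := core_notin K sN.
  by move: slack0; rewrite rs rp; lia.
have leS : (#|S| <= #|V|)%N := max_card _.
have lt_d := core_order K sS.
apply: wp_seq.
pose I B j st' (_ : store) M' := [/\ var st' "e"%string = 0 + j%:Z,
  stored st' & (B + 20 * (#|E| - j) + 10 <= M')%N].
pose I1 j st' q' M' :=
  I (20 * #|V| + 20 * #|E| + 60)%N j st' q' M' /\ running st' S tau d c.
apply: (@wp_for _ _ _ _ _ _ _ 0 #|E| I1) => //.
- by move=> /=; lia.
- by move=> M1 /= eqM1; split=> //; split=> //; lia.
- move=> j st1 q1 M1 [[eqe sto1 leM1] _]; split=> //=; last lia.
  by rewrite (in_m sto1).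
- move=> j st1 q1 M1 M2 ltj [[eqe sto1 leM1] run1] /= eqM2.
  step; split=> //; first lia.
  by move=> M3 eqM3; split=> //; split=> //; lia.
move=> st1 q1 M1 M2 [[eqe1 sto1 leM1] [_ eqp1 eqs1 K1]] /= eqM2.
step; apply: wp_seq.
have run2 : running (set_var st1 "x" (var st1 "s"%string)) S tau d c by split.
apply: (wp_mono (trace_spec (B := (20 * #|E| + 30)%N) q1 run2 eqs1 sS _)).
  by lia.
move=> st2 q2 M3 [[sto2 _ _ _] leM3]; apply: wp_seq.
apply: (@wp_for _ _ _ _ _ _ _ 0 #|E| (I 10)) => //.
- by move=> /=; lia.
- by move=> M4 /= eqM4; split=> //; lia.
- move=> j st3 q3 M4 [eqe3 sto3 leM4]; split=> //=; last lia.
  by rewrite (in_m sto3).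
- move=> j st3 q3 M4 M5 ltj [eqe3 sto3 leM4] /= eqM5.
  step=> _; first step; (split=> //; first lia);
    by move=> M6 eqM6; split=> //; lia.
- move=> st3 q3 M4 M5 [_ _ leM4] /= eqM5; step; by [].
Qed.

(** * The main loop *)

(** Every unpopped vertex holds 200 credits for its own pop and 160 for each incident edge slot; the
    loop terminates because each round pops a new vertex. *)
Lemma relief_loop_spec st q S tau d c cur N M B :
  running st S tau d c -> bq_repr c cur N q ->
  (30 * (cur + N) +
   \sum_(v in ~: S) (200 + 160 * (dout v + din v)) + B + 70 <= M)%N ->
  wp (pq_call bucket_queue) relief_loop st q M (fun st' q' M' =>
    exists S' tau' d' c', [/\ running st' S' tau' d' c',
      forall x, c' x = None & (B <= M')%N]).
Proof.
move=> run rep leM; rewrite /relief_loop; apply: wp_seq.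
pose rest S := (\sum_(v in ~: S) (200 + 160 * (dout v + din v)))%N.
pose I j st' q' M' := exists S tau d c cur N,
  [/\ j = #|~: S|, running st' S tau d c,
      bq_repr c cur N q' /\ (30 * (cur + N) + rest S + B + 10 <= M')%N,
      var st' "empty"%string = (cur == 0%N : nat)%:Z &
      (0 < cur)%N <-> inhabited_pq c].
have is_empty st1 q1 S1 tau1 d1 c1 cur1 N1 M1 :
    running st1 S1 tau1 d1 c1 -> bq_repr c1 cur1 N1 q1 ->
    (30 * (cur1 + N1) + rest S1 + B + 70 <= M1)%N ->
    wp (pq_call bucket_queue) (Call "empty"%string IsEmpty [::]) st1 q1 M1
      (I #|~: S1|).
  move=> run1 rep1 leM1.
  have [z [q' [k [cur' [N' [call rep' eqz inh lek]]]]]] :=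
    bq_is_empty_spec rep1.
  apply: wp_call; first exact: call.
    by move=> /=; lia.
  move=> M' /= eqM'; exists S1, tau1, d1, c1, cur', N'; split=> //.
  by split=> //; lia.
apply: wp_mono (is_empty _ _ _ _ _ _ _ _ _ run rep leM) _ => st0 q0 M0 I0.
apply: (@wp_while _ _ _ _ _ I _ _ _ _ _ I0).
- by move=> j st1 q1 M1 [S1 [tau1 [d1 [c1 [cur1 [N1 [_ _ [_ leM1] _ _]]]]]]] /=; lia.
- move=> j st1 q1 M1 M2 [S1 [tau1 [d1 [c1 [cur1 [N1 [-> run1 [rep1 leM1] eqe inh]]]]]]].
  rewrite /= eqe => eqM2 ne.
  have inh1 : inhabited_pq c1 by apply/inh; lia.
  have [x [q' [k [cur' [N' [call rep' eqc maxc lek]]]]]] := bq_pop_spec rep1 inh1.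
  have [sto eqp eqs K] := run1.
  have [u [eqx uS eqt K']] := core_pop K maxc eqc.
  have eqrest : rest S1 = (200 + 160 * (dout u + din u) + rest (u |: S1))%N.
    rewrite /rest (bigD1 u) ?inE //=; congr (_ + _)%N.
    by apply: eq_bigl => v; rewrite !inE negb_or andbC.
  have ltS : (#|~: (u |: S1)| < #|~: S1|)%N.
    apply: proper_card; apply/properP; split.
      by rewrite setCS subsetUr.
    by exists u; rewrite !inE ?eqxx.
  apply: wp_seq; apply: wp_call; first exact: call.
    by move=> /=; lia.
  move=> M3 /= eqM3; step; rewrite eqx.
  set st3 := set_arr _ _ _ _.
  set d' := (fun _ => _) in K'; set S' := u |: S1 in K' eqrest ltS.
  (* Reserved during the scans: the potential of the pointer, the credits of the unpopped vertices,
     and 70 for the closing emptiness test and what follows it. *)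
  pose B3 := (30 * cur' + rest S' + B + 70)%N.
  have sc : scanning st3 q' S' cur' d' u
      (B3 + 160 * din u + 20 + 160 * dout u + 20) (M3 - 7).
    split=> //; first by rewrite !inE eqxx.
    exists (update c1 x None), N'; split=> //; last lia.
  apply: wp_seq; apply: (wp_mono (out_scan_spec
    (B := (B3 + 160 * din u + 20)%N) (scanning_credits sc _))).
    by lia.
  move=> st4 q4 M4 sc4; apply: wp_seq; apply: wp_mono (in_scan_spec sc4) _.
  move=> st5 q5 M5 [_ _ _ [c5 [N5 [run5 rep5 leM5]]]].
  apply: wp_mono (is_empty _ _ _ _ _ _ _ _ _ run5 rep5 _) _; first by lia.
  by move=> st6 q6 M6 I6; exists #|~: S'|.
- move=> j st1 q1 M1 M2 [S1 [tau1 [d1 [c1 [cur1 [N1 [_ run1 [_ leM1] eqe inh]]]]]]].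
  rewrite /= eqe => eqM2 cur0; exists S1, tau1, d1, c1; split=> //; last lia.
  move=> x; case eqc: (c1 x) => [t|//].
  by have /inh := inhabited_some eqc; lia.
Qed.

(** * Initialisation *)

(** Before any pop, [tau] is just an upper bound, equal to the one queued priority. *)
Lemma core_start F rr tt par :
  (forall e, e \in E -> F (idx e) = (e \in H : nat)%:Z) ->
  (forall v, rr (vnum v) = r v) -> (forall v, tt (vnum v) = 0) ->
  core F rr (upd tt (vnum p) Delta%:Z) par set0 Delta%:Z (fun=> 0%N)
    (update (fun=> None) (vnum p) (Some Delta%:Z)).
Proof.
move=> eqF eqr eqt.
have eqtp v : upd tt (vnum p) Delta%:Z (vnum v) =
    if p == v then Delta%:Z else 0.
  by rewrite /upd (inj_eq (@vnum_inj V)) eqt.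
split=> //.
- by move=> v; rewrite eqtp; case: ifP.
- by rewrite eqtp eqxx.
- by move=> v; rewrite in_set0.
- by move=> v _; rewrite eqtp eqr; split=> //; case: ifP.
- move=> v; rewrite eqtp in_set0 /update (inj_eq (@vnum_inj V)) eq_sym.
  by case: ifP => //=; rewrite ltz_nat Delta0.
- by move=> y t; rewrite /update; case: eqP => // -> _; exists p.
- by move=> v; rewrite in_set0.
- by move=> v; rewrite in_set0.
- by move=> v _; rewrite eqtp; case: eqP => // ->; left.
Qed.

(** The term [50 * Delta] pays for raising the pointer from 0 to [Delta], at 15 per step, and for
    its potential of 30 per step. *)
Lemma relief_init_spec st q M B :
  stored st -> (B + 20 * (#|V| + #|E|) + 50 * Delta + 300 <= M)%N ->
  wp (pq_call bucket_queue) relief_init st q M (fun st' q' M' =>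
    exists c cur N, [/\ running st' set0 Delta%:Z (fun=> 0%N) c,
      bq_repr c cur N q' & (30 * (cur + N) + B <= M')%N]).
Proof.
move=> sto leM; have psE := subsetP subH _ psH.
have [nV eqV] : exists k, #|V| = k by exists #|V|.
have [mE eqE] : exists k, #|E| = k by exists #|E|.
rewrite eqV eqE in leM.
rewrite /relief_init; apply: wp_seq.
pose I j st' (_ : store) M' := [/\ var st' "e"%string = 0 + j%:Z, stored st',
  forall i : nat, (i < j)%N -> arr st' "F"%string i%:Z = arr st' "H"%string i%:Z &
  (B + 20 * nV + 20 * (mE - j) + 50 * Delta + 280 <= M')%N].
apply: (@wp_for _ _ _ _ _ _ _ 0 mE I) => //.
- by move=> /=; lia.
- by move=> M1 /= eqM1; split=> //; lia.
- move=> j st1 q1 M1 [eqe sto1 _ leM1]; split=> //=; last lia.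
  by rewrite (in_m sto1) eqE.
- move=> j st1 q1 M1 M2 ltj [eqe sto1 eqF leM1] /= eqM2.
  step; split=> //; first lia.
  move=> M3 eqM3; split=> //=; last lia.
  move=> i; rewrite ltnS leq_eqVlt eqe add0r eqz_nat eq_sym.
  by case/predU1P=> [->|lti]; rewrite ?eqxx //; case: eqP => [->|_] //; exact: eqF.
move=> st1 q1 M1 M2 [_ sto1 eqF leM1] /= eqM2; apply: wp_seq.
pose J j st' (_ : store) M' := [/\ var st' "v"%string = 0 + j%:Z, stored st',
  forall e, e \in E -> arr st' "F"%string (idx e) = (e \in H : nat)%:Z,
  forall i : nat, (i < j)%N ->
    arr st' "r'"%string i%:Z = arr st' "r"%string i%:Z /\
    arr st' "t"%string i%:Z = 0 &
  (B + 20 * (nV - j) + 50 * Delta + 250 <= M')%N].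
apply: (@wp_for _ _ _ _ _ _ _ 0 nV J) => //.
- by move=> /=; lia.
- move=> M3 /= eqM3; split=> //; last lia.
  move=> e eE; rewrite /= eqF ?(in_H sto1) //.
  by rewrite -eqE -(in_size sto1) index_mem (in_mem sto1).
- move=> j st2 q2 M3 [eqv sto2 _ _ leM3]; split=> //=; last lia.
  by rewrite (in_n sto2) eqV.
- move=> j st2 q2 M3 M4 ltj [eqv sto2 eqF2 eqrt leM3] /= eqM4.
  do 2!step; split=> //; first lia.
  move=> M5 eqM5; split=> //=; last lia.
  move=> i; rewrite ltnS leq_eqVlt eqv add0r eqz_nat eq_sym.
  by case/predU1P=> [->|lti]; rewrite ?eqxx //; case: eqP => [->|_] //; exact: eqrt.
move=> st2 q2 M3 M4 [_ sto2 eqF2 eqrt leM3] /= eqM4.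
have eqr v : arr st2 "r'"%string (vnum v) = r v.
  by have [|-> _] := eqrt (enum_rank v); rewrite -?eqV ?vnum_ltn //; rewrite (in_r sto2).
have eqt v : arr st2 "t"%string (vnum v) = 0.
  by have [|_ ->] := eqrt (enum_rank v); rewrite -?eqV ?vnum_ltn //.
do 3!step; apply: wp_seq.
rewrite (in_ps sto2) (in_src sto2 psE) (in_tgt sto2 psE) /= !(in_r sto2) eqDelta.
have [z1 [q3 [k1 [call1 lek1 rep1]]]] := bq_init_spec [:: #|V|%:Z] q2.
apply: wp_call => /=; first by rewrite (in_n sto2); exact: call1.
  by lia.
move=> M5 eqM5.
have p0 : 0 <= vnum p by [].
have [z2 [q4 [k2 [call2 lek2 rep2]]]] := bq_insert_spec rep1 p0 Delta0.
apply: wp_call => /=; first by rewrite eqxx; exact: call2.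
  by lia.
move=> M6 eqM6; exists (update (fun=> None) (vnum p) (Some Delta%:Z)).
exists (maxn 0 Delta), 1%N; split=> //; last lia.
by split=> //; apply: core_start.
Qed.

(** * Total running time *)

Lemma relief_spec st q :
  stored st -> wp (pq_call bucket_queue) relief st q
    (1000 * (#|V| + #|E| + Delta)) (fun _ _ _ => True).
Proof.
(* A nonempty vertex set lets the additive constants be absorbed into the linear bound. *)
move=> sto; have V0 : (0 < #|V|)%N by apply/card_gt0P; exists p.
(* Each edge is charged 160 at both of its ends, hence 320. *)
have sum_deg : (\sum_(v in ~: set0) (200 + 160 * (dout v + din v)) =
    200 * #|V| + 320 * #|E|)%N.
  rewrite setC0 (eq_bigl xpredT) => [|v]; last by rewrite inE.
  rewrite big_split /= sum_nat_const -big_distrr big_split /= !sum_count_fiber.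
  by rewrite (in_size sto) mulnC addnn -mul2n mulnA.
apply: wp_seq; apply: (wp_mono (relief_init_spec
  (B := (300 * #|V| + 400 * #|E| + 200)%N) _ sto _)).
  by lia.
move=> st1 q1 M1 [c [cur [N [run rep leM1]]]]; apply: wp_seq.
apply: (wp_mono (relief_loop_spec
  (B := (20 * #|V| + 40 * #|E| + 100)%N) run rep _)).
  by rewrite sum_deg; lia.
move=> st2 q2 M2 [S [tau [d [c2 [run2 c0 leM2]]]]].
by apply: relief_final_spec run2 c0 _.
Qed.

End Run.

Theorem proposition4 :
  exists Q : pq_impl, pq_correct Q /\
  exists C : nat,
  forall (V : finType) (E H : {set V * V}) (r : V -> int) (p s : V),
    maximal_eulerian E H ->
    conforms E H r ->
    (p, s) \in H ->
    0 < slack r (p, s) ->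
  forall (es : seq (V * V)) (st qst : store),
    encodes E H r (p, s) es st ->
  exists (st' qst' : store) (time : nat),
    exec (pq_call Q) relief st qst st' qst' time /\
    time%:Z <= C%:Z * (#|V|%:Z + #|E|%:Z + slack r (p, s)).
Proof.
exists bucket_queue; split; first exact: bucket_queue_correct.
exists 1000%N => V E H r p s [subH _ _] conf psH slack0 es st qst enc.
have [Delta eqslack] : exists Delta : nat, slack r (p, s) = Delta%:Z.
  by exists `|slack r (p, s)|%N; lia.
rewrite eqslack in slack0 *.
have eqDelta : r s - r p - 1 = Delta%:Z by move: eqslack; rewrite /slack /=; lia.
(* The list starts [outpos] and [inpos] are taken to be the values in the initial memory. *)
have sto := encodes_stored (fun=> erefl) (fun=> erefl) enc.
have [st' [q' [k [M [ex lek _]]]]] :=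
  relief_spec subH conf psH slack0 eqDelta qst sto.
by exists st', q', k; split=> //; lia.
Qed.
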